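(* Let $n\ge1$, $\gamma\in[0,1]$ and $\beta=\frac{2}{2-\gamma}$. Then for every $R>0$ there exists a function $U\in C([R,\infty))\cap C^2((R,\infty))$, positive and increasing on $(R,\infty)$, such that $$U''+\Big(\frac{n-1}{r}+\frac r2\Big)U'-\frac\beta2U=\gamma U^{\gamma-1}\ \text{ in }(R,\infty),\qquad U(R)=0,\qquad (U^{1/\beta})'(R)=\frac{\sqrt2}{\beta},$$ and $$\lim_{r\to\infty}\frac{U(r)}{r^\beta}=c\quad\text{for some }c>0.$$
   Context: $(U^{1/\beta})'(R)$ denotes the right derivative at $R$, i.e. $\lim_{r\downarrow R}U^{1/\beta}(r)/(r-R)$. For $\gamma=0$ the right-hand side $\gamma U^{\gamma-1}$ is $0$. *)

(* Defs.v *)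
From Stdlib Require Import Reals.
From Coquelicot Require Import Coquelicot.
Open Scope R_scope.

Definition C2_on_open_right (a : R) (U : R -> R) : Prop :=
  forall r, a < r ->
    ex_derive U r /\ ex_derive (Derive U) r /\ continuous (Derive (Derive U)) r.

Definition continuous_on_closed_right (a : R) (U : R -> R) : Prop :=
  forall r, a <= r ->
    filterlim U (within (fun x => a <= x) (locally r)) (locally (U r)).

(* Main.v *)
Require Import Defs.
From Stdlib Require Import Reals Lra Lia Classical_Prop.
From Coquelicot Require Import Coquelicot.
Open Scope R_scope.

(** Write [A r = (n-1)/r + r/2], [rho r = r^(n-1) e^(r^2/4)] (so [rho' = A rho]), [s = r - R] and
    [alpha = 1 - gamma].

    Existence. The homogeneous equation has an explicit positive solution [phi], a Kummer series.
    Putting [U = phi v] turns the problem into [(rho phi^2 v')' = gamma rho phi U^(gamma-1)].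
    With [U = s^beta u] and [M_d j (s) = s^(-d) int_0^s d t^(d-1) j(t) dt], the integrated form is
      [u = (2/beta^2) phi M_beta (1/(rho phi^2) M_(beta-1) (rho phi u^(-alpha)))],
    whose right-hand side is order reversing and homogeneous of degree [-alpha] in [u]. In the
    variable [ln u] it is therefore an [alpha]-contraction, uniformly on compact sets; this settles
    [gamma > 0]. For [gamma = 0] the right-hand side depends on [u] only through [u(0)]. At
    [s = 0] the fixed point equation reads [u(0)^(2/beta) = 2/beta^2], the required slope.

    Growth. If [psi > 0] is a supersolution of the homogeneous equation then [U/psi] is increasing.
    [psi = 1] gives [U' > 0], and [psi = (r^2+2n)^(beta/2)] gives [U >= kappa r^beta]. Moreover
    [Q = r U' - beta U] satisfies [Q' <= - (r/2) Q + C r], so it is bounded above by some [C2], and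
    [U/r^beta + (C2/beta) r^(-beta)] is decreasing. *)

(** * A positive solution of the homogeneous equation *)

(** Coefficients [(a)_k / ((b)_k k!)] of Kummer's confluent hypergeometric function [M(a,b,x)],
    given through their successive ratios. *)
Fixpoint kummer_coeff (a b : R) (k : nat) : R :=
  match k with
  | O => 1
  | S k => kummer_coeff a b k * ((INR k + a) / ((INR k + 1) * (INR k + b)))
  end.

Lemma kummer_coeff_pos (a b : R) (k : nat) :
  0 < a -> 0 < b -> 0 < kummer_coeff a b k.
Proof.
  intros Ha Hb; induction k as [|k IH]; simpl; [lra|].
  assert (Hk := pos_INR k).
  apply Rmult_lt_0_compat; [exact IH|].
  apply Rdiv_lt_0_compat; [lra|]. apply Rmult_lt_0_compat; lra.
Qed.

(** Ratio test: the quotient of consecutive coefficients is at most [(1 + a/b) / (k + 1)], because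
    [k + a <= (1 + a/b) (k + b)]. *)
Lemma kummer_CV_radius (a b : R) :
  0 < a -> 0 < b -> CV_radius (kummer_coeff a b) = p_infty.
Proof.
  intros Ha Hb. apply CV_radius_infinite_DAlembert.
  - intros k; apply Rgt_not_eq, kummer_coeff_pos; assumption.
  - apply is_lim_seq_le_le with (u := fun _ => 0) (w := fun k => (1 + a / b) * / INR (S k)).
    + intros k. assert (Hc := kummer_coeff_pos a b k Ha Hb). assert (Hk := pos_INR k).
      split; [apply Rabs_pos|]. rewrite S_INR; simpl.
      replace (kummer_coeff a b k * ((INR k + a) / ((INR k + 1) * (INR k + b)))
               / kummer_coeff a b k)
        with ((INR k + a) / (INR k + b) * / (INR k + 1)) by (field; lra).
      assert (0 < (INR k + a) / (INR k + b)) by (apply Rdiv_lt_0_compat; lra).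
      assert (0 < / (INR k + 1)) by (apply Rinv_0_lt_compat; lra).
      rewrite Rabs_pos_eq by (apply Rmult_le_pos; lra).
      apply Rmult_le_compat_r; [lra|].
      apply Rmult_le_reg_r with (INR k + b); [lra|].
      replace ((INR k + a) / (INR k + b) * (INR k + b)) with (INR k + a) by (field; lra).
      replace ((1 + a / b) * (INR k + b)) with (INR k + b + a + INR k * (a / b)) by (field; lra).
      assert (0 <= INR k * (a / b)).
      { apply Rmult_le_pos; [lra|]. apply Rlt_le, Rdiv_lt_0_compat; lra. }
      lra.
    + apply is_lim_seq_const.
    + replace (Finite 0) with (Rbar_mult (1 + a / b) 0) by (simpl; f_equal; ring).
      apply is_lim_seq_scal_l.
      apply (is_lim_seq_incr_1 (fun k => / INR k)).
      replace (Finite 0) with (Rbar_inv p_infty) by reflexivity.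
      apply is_lim_seq_inv; [apply is_lim_seq_INR|discriminate].
Qed.

Lemma PSeries_pos (c : nat -> R) (x : R) :
  CV_radius c = p_infty -> (forall k, 0 < c k) -> 0 <= x -> 0 < PSeries c x.
Proof.
  intros Hr Hc Hx.
  assert (He : ex_pseries c x).
  { apply CV_radius_inside. rewrite Hr. exact I. }
  rewrite PSeries_decr_1 by exact He.
  assert (0 <= PSeries (PS_decr_1 c) x).
  { rewrite <- (PSeries_const_0 x). apply Series_le.
    - intros k; split; [lra|]. rewrite Rmult_0_l. apply Rmult_le_pos; [apply Rlt_le, Hc|apply pow_le; lra].
    - apply (ex_series_ext (fun k => scal (pow_n x k) (PS_decr_1 c k))).
      + intros k. rewrite pow_n_pow. unfold scal; simpl; unfold mult; simpl. ring.
      + apply CV_radius_inside. rewrite CV_radius_decr_1, Hr. exact I. }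
  specialize (Hc 0%nat). assert (0 <= x * PSeries (PS_decr_1 c) x) by (apply Rmult_le_pos; lra).
  lra.
Qed.

Lemma is_derive_eq (f : R -> R) (x l l' : R) : is_derive f x l -> l = l' -> is_derive f x l'.
Proof. intros H <-; exact H. Qed.

(** At degree [k] the left side has coefficient [(k+1)(k+b) c_(k+1) - (k+a) c_k], which vanishes by
    the recursion for [c]. *)
Lemma kummer_equation (a b x : R) : 0 < a -> 0 < b ->
  let c := kummer_coeff a b in
  x * PSeries (PS_derive (PS_derive c)) x + (b - x) * PSeries (PS_derive c) x
    - a * PSeries c x = 0.
Proof.
  intros Ha Hb c.
  assert (Hr := kummer_CV_radius a b Ha Hb : CV_radius c = p_infty).
  assert (E : forall d, CV_radius d = p_infty -> ex_pseries d x)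
    by (intros d Hd; apply CV_radius_inside; rewrite Hd; exact I).
  assert (H1 : CV_radius (PS_derive c) = p_infty) by (rewrite CV_radius_derive; exact Hr).
  assert (H2 : CV_radius (PS_derive (PS_derive c)) = p_infty)
    by (rewrite CV_radius_derive; exact H1).
  (* Each factor [x] becomes an index shift, so that the whole expression is one power series and
     can be compared with 0 coefficientwise. *)
  transitivity (PSeries (PS_incr_1 (PS_derive (PS_derive c))) x + b * PSeries (PS_derive c) x
     - PSeries (PS_incr_1 (PS_derive c)) x - a * PSeries c x).
  { rewrite !PSeries_incr_1. ring. }
  rewrite <- !PSeries_scal.
  assert (P1 : ex_pseries (PS_incr_1 (PS_derive (PS_derive c))) x)
    by (apply ex_pseries_incr_1, E; exact H2).
  assert (P2 : ex_pseries (PS_scal b (PS_derive c)) x)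
    by (apply ex_pseries_scal; [apply Rmult_comm|apply E; exact H1]).
  assert (P3 : ex_pseries (PS_incr_1 (PS_derive c)) x)
    by (apply ex_pseries_incr_1, E; exact H1).
  assert (P4 : ex_pseries (PS_scal a c) x)
    by (apply ex_pseries_scal; [apply Rmult_comm|apply E; exact Hr]).
  assert (P5 := ex_pseries_plus _ _ x P1 P2).
  assert (P6 := ex_pseries_minus _ _ x P5 P3).
  rewrite <- PSeries_plus, <- !PSeries_minus.
  all: try (exact P1) || (exact P2) || (exact P3) || (exact P4)
     || (exact P5) || (exact P6).
  rewrite <- (PSeries_const_0 x). apply PSeries_ext. intros k.
  unfold PS_minus, PS_plus, PS_scal, PS_opp, PS_incr_1, PS_derive, plus, opp, scal, zero; simpl;
    unfold mult; simpl.
  destruct k as [|k].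
  - simpl. unfold c; simpl. field. lra.
  - unfold c. cbn [kummer_coeff].
    rewrite !S_INR. assert (Hk := pos_INR k). 
    change (match k with 0%nat => 1 | S _ => INR k + 1 end) with (INR (S k)).
    rewrite !S_INR. field. lra.
Qed.

(** The witness is [phi = e^(-x) M((n+beta)/2, n/2, x)] with [x = r^2/4]. By Kummer's transformation
    this is [M(-beta/2, n/2, -r^2/4)]; the form with the exponential is preferred because all
    coefficients of its series are positive, which makes [phi > 0] visible. *)
Lemma homogeneous_solution (n : nat) (beta : R) : (1 <= n)%nat -> 0 < beta ->
  exists phi phi1 : R -> R,
    (forall r, 0 < phi r) /\ (forall r, is_derive phi r (phi1 r)) /\
    (forall r, 0 < r -> is_derive phi1 r
       (beta / 2 * phi r - ((INR n - 1) / r + r / 2) * phi1 r)).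
Proof.
  intros Hn Hb.
  assert (Hn1 : 1 <= INR n) by (apply (le_INR 1); exact Hn).
  set (a := (INR n + beta) / 2). set (b := INR n / 2).
  assert (Ha : 0 < a) by (unfold a; lra). assert (Hb' : 0 < b) by (unfold b; lra).
  set (c := kummer_coeff a b).
  assert (Hr := kummer_CV_radius a b Ha Hb' : CV_radius c = p_infty).
  assert (H1 : CV_radius (PS_derive c) = p_infty) by (rewrite CV_radius_derive; exact Hr).
  set (g := PSeries c). set (g1 := PSeries (PS_derive c)).
  set (g2 := PSeries (PS_derive (PS_derive c))).
  assert (D0 : forall x, is_derive g x (g1 x)).
  { intros x. apply is_derive_PSeries. rewrite Hr. exact I. }
  assert (D1 : forall x, is_derive g1 x (g2 x)).
  { intros x. apply is_derive_PSeries. rewrite H1. exact I. }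
  assert (D : forall f f1 : R -> R, (forall x, is_derive f x (f1 x)) ->
     forall r, is_derive (fun r => f (r * r / 4)) r (r / 2 * f1 (r * r / 4))).
  { intros f f1 Hf r.
    apply (is_derive_comp f (fun r => r * r / 4)); [apply Hf|].
    auto_derive; [exact I|]. field. }
  assert (De : forall r, is_derive (fun r => exp (- (r * r / 4))) r
                          (- (r / 2) * exp (- (r * r / 4)))).
  { intros r. auto_derive; [exact I|]. unfold Rdiv; ring_simplify; field. }
  exists (fun r => exp (- (r * r / 4)) * g (r * r / 4)).
  exists (fun r => exp (- (r * r / 4)) * (r / 2 * (g1 (r * r / 4) - g (r * r / 4)))).
  split; [|split].
  - intros r. apply Rmult_lt_0_compat; [apply exp_pos|].
    apply PSeries_pos; [exact Hr|intros k; apply kummer_coeff_pos; assumption|nra].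
  - intros r.
    eapply is_derive_eq.
    { apply (is_derive_mult (fun r => exp (- (r * r / 4))) (fun r => g (r * r / 4)) r);
        [apply De|apply D, D0|intros; apply Rmult_comm]. }
    unfold plus, mult; simpl. ring.
  - intros r Hr0.
    eapply is_derive_eq.
    { apply (is_derive_mult (fun r => exp (- (r * r / 4)))
        (fun r => (r / 2 * (g1 (r * r / 4) - g (r * r / 4)))) r);
        [apply De| |intros; apply Rmult_comm].
      apply (is_derive_mult (fun r => r / 2) (fun r => g1 (r * r / 4) - g (r * r / 4)) r);
        [| |intros; apply Rmult_comm].
      - instantiate (1 := 1 / 2). auto_derive; [exact I|field].
      - apply (is_derive_minus (fun r => g1 (r * r / 4)) (fun r => g (r * r / 4)));
        [apply (D g1 g2), D1|apply D, D0]. }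
    assert (K := kummer_equation a b (r * r / 4) Ha Hb').
    cbv zeta in K. fold c in K. fold g g1 g2 in K.
    unfold plus, mult, minus, opp; simpl. unfold plus, opp; simpl. 
    set (x0 := g (r * r / 4)) in *. set (x1 := g1 (r * r / 4)) in *.
    set (x2 := g2 (r * r / 4)) in *. set (e := exp (- (r * r / 4))).
    (* The second derivative of the series enters [phi''] only through the product [(r^2/4) g2], so
       Kummer's equation can be used without dividing by its leading coefficient. *)
    assert (K2 : r * r / 4 * x2 = a * x0 - (b - r * r / 4) * x1) by lra.
    transitivity (e * (r * r / 4 * x2) + e * ((x1 - x0) / 2 + r * r / 4 * (x0 - 2 * x1))).
    { field. }
    rewrite K2. unfold a, b. field. lra.
Qed.

(** * Weighted averages *)

(** [Rpower x d] equals 1 for [x <= 0], since [ln] is 0 there. Extending by 0 instead gives a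
    function continuous on the whole line when [d > 0]. *)
Definition pos_power (d x : R) : R := if Rle_dec x 0 then 0 else Rpower x d.

Lemma pos_power_pos (d x : R) : 0 < x -> pos_power d x = Rpower x d.
Proof. intros Hx; unfold pos_power; destruct (Rle_dec x 0); [lra|reflexivity]. Qed.

Lemma pos_power_nonpos (d x : R) : x <= 0 -> pos_power d x = 0.
Proof. intros Hx; unfold pos_power; destruct (Rle_dec x 0); [reflexivity|lra]. Qed.

Lemma is_derive_Rpower (x d : R) : 0 < x ->
  is_derive (fun y => Rpower y d) x (d * Rpower x (d - 1)).
Proof. intros Hx. apply is_derive_Reals, derivable_pt_lim_power, Hx. Qed.

Lemma is_derive_continuous (f : R -> R) (x l : R) : is_derive f x l -> continuous f x.
Proof. intros H. apply (ex_derive_continuous f). exists l; exact H. Qed.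

Lemma continuous_eps (f : R -> R) (x : R) :
  (forall eps : posreal, exists d : posreal, forall y, Rabs (y - x) < d -> Rabs (f y - f x) < eps) ->
  continuous f x.
Proof.
  intros H. apply filterlim_locally. intros eps. destruct (H eps) as [d Hd].
  exists d. intros y Hy. apply Hd, Hy.
Qed.

Lemma continuous_eps_inv (f : R -> R) (x : R) : continuous f x ->
  forall eps : posreal, exists d : posreal, forall y, Rabs (y - x) < d -> Rabs (f y - f x) < eps.
Proof.
  intros H eps.
  destruct (proj1 (filterlim_locally f (f x)) H eps) as [d Hd].
  exists d. intros y Hy. apply Hd, Hy.
Qed.

Lemma continuous_pos_power (d x : R) : 0 < d -> continuous (pos_power d) x.
Proof.
  intros Hd. destruct (Rtotal_order x 0) as [Hx|[Hx|Hx]].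
  - apply (continuous_ext_loc _ (fun _ => 0)); [|apply continuous_const].
    generalize (open_lt 0 x Hx); apply filter_imp.
    intros y Hy; symmetry; apply pos_power_nonpos; simpl in Hy; lra.
  - subst x. apply continuous_eps. intros eps.
    exists (mkposreal (Rpower eps (1 / d)) (exp_pos _)). simpl. intros y Hy.
    rewrite (pos_power_nonpos d 0), Rminus_0_r in * by lra.
    destruct (Rle_lt_dec y 0) as [Hy0|Hy0].
    + rewrite pos_power_nonpos by exact Hy0. rewrite Rabs_R0. apply cond_pos.
    + rewrite pos_power_pos by exact Hy0. rewrite Rabs_pos_eq in Hy by lra.
      rewrite Rabs_pos_eq by (apply Rlt_le, exp_pos).
      apply Rlt_le_trans with (Rpower (Rpower eps (1 / d)) d).
      * apply Rlt_Rpower_l; [exact Hd|lra].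
      * rewrite Rpower_mult. replace (1 / d * d) with 1 by (field; lra).
        rewrite Rpower_1 by apply cond_pos. apply Rle_refl.
  - apply (continuous_ext_loc _ (fun y => Rpower y d)).
    + generalize (open_gt 0 x Hx); apply filter_imp.
      intros y Hy; symmetry; apply pos_power_pos; exact Hy.
    + eapply is_derive_continuous, is_derive_Rpower, Hx.
Qed.

(** The ratio [t/s] after the substitution [y = (t/s)^d], which turns [s^(-d) d t^(d-1) dt] into
    [dy] on [[0,1]]. *)
Definition average_kernel (d y : R) : R := if Req_EM_T d 0 then 0 else pos_power (1 / d) y.

(* For [d > 0] this is [s^(-d) * int_0^s d t^(d-1) j(t) dt], written as a proper integral that
   still makes sense at [s = 0]; [d = 0] gives its limit, evaluation at [0]. *)
Definition average (d : R) (j : R -> R) (s : R) : R :=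
  RInt (fun y => j (Rmax 0 s * average_kernel d y)) 0 1.

Lemma continuous_average_kernel (d y : R) : 0 <= d -> continuous (average_kernel d) y.
Proof.
  intros Hd. unfold average_kernel. destruct (Req_EM_T d 0) as [E|E].
  - apply continuous_const.
  - apply continuous_pos_power. apply Rdiv_lt_0_compat; lra.
Qed.

Lemma average_kernel_bound (d y : R) : 0 <= d -> 0 <= y <= 1 -> 0 <= average_kernel d y <= 1.
Proof.
  intros Hd Hy. unfold average_kernel. destruct (Req_EM_T d 0) as [E|E]; [lra|].
  destruct (Rle_lt_dec y 0) as [Hy0|Hy0].
  - rewrite pos_power_nonpos; lra.
  - rewrite pos_power_pos by lra. split; [apply Rlt_le, exp_pos|].
    replace 1 with (Rpower 1 (1 / d)) at 2 by (unfold Rpower; rewrite ln_1, Rmult_0_r; apply exp_0).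
    apply Rle_Rpower_l; [|lra]. apply Rlt_le, Rdiv_lt_0_compat; lra.
Qed.

Lemma average_arg_bound (d s y : R) : 0 <= d -> 0 <= y <= 1 ->
  0 <= Rmax 0 s * average_kernel d y <= Rmax 0 s.
Proof.
  intros Hd Hy. assert (K := average_kernel_bound d y Hd Hy).
  assert (Hs := Rmax_l 0 s). split; [apply Rmult_le_pos; lra|].
  rewrite <- (Rmult_1_r (Rmax 0 s)) at 2. apply Rmult_le_compat_l; lra.
Qed.

Section average.
Variable d : R.
Hypothesis Hd : 0 <= d.

Lemma continuous_average_integrand (j : R -> R) (s y : R) : (forall t, continuous j t) ->
  continuous (fun y => j (Rmax 0 s * average_kernel d y)) y.
Proof.
  intros Hj. apply (continuous_comp (fun y => Rmax 0 s * average_kernel d y) j); [|apply Hj].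
  apply (continuous_mult (fun _ => Rmax 0 s) (average_kernel d));
    [apply continuous_const|apply continuous_average_kernel, Hd].
Qed.

Lemma ex_RInt_average (j : R -> R) (s : R) : (forall t, continuous j t) ->
  ex_RInt (fun y => j (Rmax 0 s * average_kernel d y)) 0 1.
Proof.
  intros Hj. apply (ex_RInt_continuous (V := R_CompleteNormedModule)).
  intros y _. apply continuous_average_integrand, Hj.
Qed.

Lemma average_const (c s : R) : average d (fun _ => c) s = c.
Proof.
  unfold average. rewrite RInt_const. unfold scal; simpl; unfold mult; simpl. ring.
Qed.

Lemma average_0 (j : R -> R) : average d j 0 = j 0.
Proof.
  rewrite <- (average_const (j 0) 0). unfold average. apply RInt_ext.
  intros y _. f_equal. rewrite Rmax_left by lra. ring.
Qed.

Lemma average_d0 (j : R -> R) (s : R) : d = 0 -> average d j s = j 0.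
Proof.
  intros E. rewrite <- (average_const (j 0) 0). unfold average. apply RInt_ext.
  intros y _. f_equal. unfold average_kernel. destruct (Req_EM_T d 0); [ring|lra].
Qed.

(** The comparison is needed only on [[0, max(0,s)]]. This locality is what later gives a
    contraction on every compact interval separately. *)
Lemma average_le (j k : R -> R) (s : R) :
  (forall t, continuous j t) -> (forall t, continuous k t) ->
  (forall t, 0 <= t <= Rmax 0 s -> j t <= k t) -> average d j s <= average d k s.
Proof.
  intros Hj Hk H. apply RInt_le; [lra|apply ex_RInt_average, Hj|apply ex_RInt_average, Hk|].
  intros y Hy. apply H, average_arg_bound; [exact Hd|lra].
Qed.

Lemma average_scal (c : R) (j : R -> R) (s : R) : (forall t, continuous j t) ->
  average d (fun t => c * j t) s = c * average d j s.
Proof.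
  intros Hj. unfold average.
  apply (RInt_scal (fun y => j (Rmax 0 s * average_kernel d y)) 0 1 c).
  apply ex_RInt_average, Hj.
Qed.

Lemma average_pos (j : R -> R) (s : R) : (forall t, continuous j t) ->
  (forall t, 0 < j t) -> 0 < average d j s.
Proof.
  intros Hj H. apply RInt_gt_0; [lra|intros; apply H|].
  intros; apply continuous_average_integrand, Hj.
Qed.

(** Rescaling by [s^d] moves all dependence on [s] into the upper limit of integration, so that the
    fundamental theorem of calculus applies. *)
Lemma Rpower_mult_average (j : R -> R) (s : R) : (forall t, continuous j t) -> 0 < d -> 0 < s ->
  Rpower s d * average d j s = RInt (fun y => j (pos_power (1 / d) y)) 0 (Rpower s d).
Proof.
  intros Hj Hd0 Hs. set (u := Rpower s d).
  assert (Hu : 0 < u) by apply exp_pos.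
  assert (Hc : forall y, continuous (fun y => j (pos_power (1 / d) y)) y).
  { intros y. apply continuous_comp; [|apply Hj]. apply continuous_pos_power.
    apply Rdiv_lt_0_compat; lra. }
  replace (RInt (fun y => j (pos_power (1 / d) y)) 0 u)
    with (RInt (fun y => j (pos_power (1 / d) y)) (u * 0 + 0) (u * 1 + 0)) by (f_equal; ring).
  rewrite <- (RInt_comp_lin (V := R_CompleteNormedModule)).
  2: { apply (ex_RInt_continuous (V := R_CompleteNormedModule)). intros; apply Hc. }
  rewrite (RInt_scal (V := R_CompleteNormedModule) (fun y => j (pos_power (1 / d) (u * y + 0)))).
  2: { apply (ex_RInt_continuous (V := R_CompleteNormedModule)). intros z _.
       apply (continuous_comp (fun y => u * y + 0) (fun y => j (pos_power (1 / d) y))); [|apply Hc].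
       eapply is_derive_continuous. auto_derive; [exact I|reflexivity]. }
  unfold scal; simpl; unfold mult; simpl. f_equal.
  apply RInt_ext. rewrite Rmin_left, Rmax_right by lra. intros y Hy.
  f_equal. rewrite Rmax_right, Rplus_0_r by lra.
  unfold average_kernel. destruct (Req_EM_T d 0) as [E|_]; [lra|].
  rewrite !pos_power_pos; [|nra|lra].
  rewrite <- Rpower_mult_distr by lra. f_equal. unfold u.
  rewrite Rpower_mult. replace (d * (1 / d)) with 1 by (field; lra).
  rewrite Rpower_1; [reflexivity|exact Hs].
Qed.

(** For [d > 0] this is the fundamental theorem of calculus composed with [s^d]; for [d = 0] the
    function is the constant [j 0] and the factor [d] kills the right side. *)
Lemma is_derive_average (j : R -> R) (s : R) : (forall t, continuous j t) -> 0 < s ->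
  is_derive (fun s => Rpower s d * average d j s) s (d * Rpower s (d - 1) * j s).
Proof.
  intros Hj Hs. destruct (Req_EM_T d 0) as [E|E].
  - apply is_derive_ext with (fun _ : R => j 0).
    + intros t. unfold Rpower.
      rewrite average_d0, E, Rmult_0_l, exp_0 by exact E. symmetry; apply Rmult_1_l.
    + rewrite E, !Rmult_0_l. apply (is_derive_const (j 0) s).
  - apply is_derive_ext_loc with (fun s => RInt (fun y => j (pos_power (1 / d) y)) 0 (Rpower s d)).
    { generalize (open_gt 0 s Hs). apply filter_imp. intros t Ht.
      symmetry; apply Rpower_mult_average; [exact Hj|lra|exact Ht]. }
    assert (Hc : forall y, continuous (fun y => j (pos_power (1 / d) y)) y).
    { intros y. apply continuous_comp; [|apply Hj]. apply continuous_pos_power.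
      apply Rdiv_lt_0_compat; lra. }
    replace (d * Rpower s (d - 1) * j s)
      with (d * Rpower s (d - 1) * j (pos_power (1 / d) (Rpower s d))).
    2: { f_equal. f_equal. rewrite pos_power_pos by apply exp_pos.
         rewrite Rpower_mult. replace (d * (1 / d)) with 1 by (field; lra). apply Rpower_1, Hs. }
    apply (is_derive_comp (fun u => RInt (fun y => j (pos_power (1 / d) y)) 0 u)
             (fun s => Rpower s d)); [|apply is_derive_Rpower, Hs].
    apply (is_derive_RInt (fun y => j (pos_power (1 / d) y)) _ 0); [|apply Hc].
    apply filter_forall. intros u. apply (RInt_correct (V := R_CompleteNormedModule)).
    apply (ex_RInt_continuous (V := R_CompleteNormedModule)). intros; apply Hc.
Qed.

(** The average is constant for [s < 0], is squeezed between averages of constants near [s = 0], and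
    for [s > 0] is [s^(-d)] times a differentiable function. *)
Lemma continuous_average (j : R -> R) (s : R) : (forall t, continuous j t) ->
  continuous (average d j) s.
Proof.
  intros Hj. destruct (Rtotal_order s 0) as [Hs|[Hs|Hs]].
  - apply (continuous_ext_loc _ (fun _ => j 0)); [|apply continuous_const].
    generalize (open_lt 0 s Hs); apply filter_imp. simpl. intros y Hy.
    rewrite <- (average_0 j). unfold average. f_equal.
    rewrite !Rmax_left by lra. reflexivity.
  - subst s. apply continuous_eps. intros eps.
    assert (He := cond_pos eps).
    destruct (continuous_eps_inv j 0 (Hj 0) (mkposreal (eps / 2) ltac:(lra))) as [e H].
    simpl in H. exists e. intros y Hy. rewrite average_0.
    assert (Hb : forall t, 0 <= t <= Rmax 0 y -> j 0 - eps / 2 <= j t <= j 0 + eps / 2).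
    { intros t Ht.
      assert (Hm : Rmax 0 y <= Rabs y) by (apply Rmax_lub; [apply Rabs_pos|apply Rle_abs]).
      rewrite Rminus_0_r in Hy.
      specialize (H t). rewrite Rminus_0_r, (Rabs_pos_eq t) in H by lra.
      assert (H' := H ltac:(lra)). apply Rabs_def2 in H'. lra. }
    apply Rabs_def1.
    + assert (average d j y <= average d (fun _ => j 0 + eps / 2) y).
      { apply average_le; [exact Hj|intros; apply continuous_const|].
        intros t Ht; apply Hb, Ht. }
      rewrite average_const in H0. lra.
    + assert (average d (fun _ => j 0 - eps / 2) y <= average d j y).
      { apply average_le; [intros; apply continuous_const|exact Hj|].
        intros t Ht; apply Hb, Ht. }
      rewrite average_const in H0. lra.
  - apply (continuous_ext_loc _ (fun s => Rpower s (- d) * (Rpower s d * average d j s))).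
    + generalize (open_gt 0 s Hs); apply filter_imp. intros y Hy.
      rewrite <- Rmult_assoc, <- Rpower_plus. replace (- d + d) with 0 by ring.
      rewrite Rpower_O by exact Hy. symmetry; ring_simplify; reflexivity.
    + apply (continuous_mult (fun s => Rpower s (- d)) (fun s => Rpower s d * average d j s)).
      * eapply is_derive_continuous, is_derive_Rpower, Hs.
      * eapply is_derive_continuous, is_derive_average; [exact Hj|exact Hs].
Qed.
End average.

(** * The fixed point *)

Lemma continuous_bounded (f : R -> R) (a b : R) : (forall t, continuous f t) ->
  exists D, forall t, a <= t <= b -> f t <= D.
Proof.
  intros Hf. destruct (Rle_lt_dec a b) as [Hab|Hab].
  - destruct (continuity_ab_maj f a b Hab) as [m [Hm _]].
    + intros c _. apply continuity_pt_filterlim, Hf.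
    + exists (f m); exact Hm.
  - exists 0. intros t Ht; lra.
Qed.

Lemma geom_small (q C eps : R) : 0 <= q < 1 -> 0 < eps -> exists k : nat, q ^ k * C < eps.
Proof.
  intros Hq He.
  assert (L : is_lim_seq (fun k => q ^ k * C) (Finite (0 * C))).
  { apply (is_lim_seq_scal_r _ C (Finite 0)). apply is_lim_seq_geom. rewrite Rabs_pos_eq; lra. }
  rewrite Rmult_0_l in L. apply is_lim_seq_spec in L.
  destruct (L (mkposreal eps He)) as [N HN]. exists N.
  specialize (HN N (Nat.le_refl N)). simpl in HN. apply Rabs_def2 in HN. lra.
Qed.

(** Banach's theorem for continuous functions on the line with the seminorms [sup] over
    [[-rad, rad]]: the factor [q] is the same for all of them, so the Picard iterates from 0
    converge locally uniformly to a continuous limit. *)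
Lemma banach_locally_uniform (T : (R -> R) -> R -> R) (q : R) :
  0 <= q < 1 ->
  (forall x, (forall t, continuous x t) -> forall t, continuous (T x) t) ->
  (forall rad d x y, (forall t, continuous x t) -> (forall t, continuous y t) ->
     (forall t, Rabs t <= rad -> Rabs (x t - y t) <= d) ->
     forall t, Rabs t <= rad -> Rabs (T x t - T y t) <= q * d) ->
  exists x, (forall t, continuous x t) /\ forall t, x t = T x t.
Proof.
  intros Hq Tc Tq.
  set (u := fun k => Nat.iter k T (fun _ => 0)).
  assert (uc : forall k t, continuous (u k) t).
  { induction k as [|k IH]; intros t; [apply continuous_const|apply Tc, IH]. }
  assert (B : forall rad, exists C, forall k m t, Rabs t <= rad -> Rabs (u (m + k)%nat t - u k t) <= q ^ k * C).
  { intros rad.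
    destruct (continuous_bounded (fun t => Rabs (T (fun _ => 0) t)) (- rad) rad) as [D HD].
    { intros t. apply (continuous_comp (T (fun _ => 0)) Rabs); [apply (uc 1%nat)|].
      apply continuous_Rabs. }
    assert (H1 : forall k t, Rabs t <= rad -> Rabs (u (k + 1)%nat t - u k t) <= q ^ k * D).
    { induction k as [|k IH]; intros t Ht.
      - simpl. rewrite Rminus_0_r, Rmult_1_l. apply HD. apply Rabs_le_between, Ht.
      - simpl pow. rewrite Rmult_assoc. apply (Tq rad); [apply uc|apply uc|exact IH|exact Ht]. }
    exists (D / (1 - q)). intros k m t Ht.
    assert (HD0 : 0 <= D) by (eapply Rle_trans; [apply Rabs_pos|apply HD, Rabs_le_between, Ht]).
    assert (Hk : 0 <= q ^ k) by (apply pow_le; lra).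
    (* Telescoping the increments bounded by [q^k D] gives a finite geometric sum. *)
    assert (Hm : Rabs (u (m + k)%nat t - u k t) <= q ^ k * D * ((1 - q ^ m) / (1 - q))).
    { induction m as [|m IH].
      - simpl. rewrite !Rminus_eq_0, Rabs_R0. unfold Rdiv. rewrite Rmult_0_l, Rmult_0_r. apply Rle_refl.
      - replace (u (S m + k)%nat t - u k t)
          with ((u (m + k + 1)%nat t - u (m + k)%nat t) + (u (m + k)%nat t - u k t))
          by (replace (m + k + 1)%nat with (S m + k)%nat by lia; ring).
        eapply Rle_trans; [apply Rabs_triang|].
        eapply Rle_trans; [apply Rplus_le_compat; [apply H1, Ht|exact IH]|].
        right. rewrite pow_add. simpl. field. lra. }
    eapply Rle_trans; [exact Hm|].
    replace (q ^ k * (D / (1 - q))) with (q ^ k * D * (1 / (1 - q))) by (field; lra).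
    apply Rmult_le_compat_l; [apply Rmult_le_pos; assumption|].
    apply Rmult_le_compat_r; [apply Rlt_le, Rinv_0_lt_compat; lra|].
    assert (0 <= q ^ m) by (apply pow_le; lra). lra. }
  assert (L : forall t, ex_finite_lim_seq (fun k => u k t)).
  { intros t. apply ex_lim_seq_cauchy_corr. intros eps.
    destruct (B (Rabs t)) as [C HC].
    destruct (geom_small q (2 * C) eps Hq (cond_pos eps)) as [N HN].
    exists N. intros n m Hn Hm.
    assert (H1 := HC N (n - N)%nat t (Rle_refl _)). assert (H2 := HC N (m - N)%nat t (Rle_refl _)).
    rewrite Nat.sub_add in H1, H2 by assumption.
    rewrite (Rabs_minus_sym (u m t)) in H2.
    replace (u n t - u m t) with ((u n t - u N t) + (u N t - u m t)) by ring.
    eapply Rle_lt_trans; [apply Rabs_triang|]. lra. }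
  set (x := fun t => real (Lim_seq (fun k => u k t))).
  assert (Lx : forall t, is_lim_seq (fun k => u k t) (x t)).
  { intros t. apply Lim_seq_correct', L. }
  assert (E : forall rad, exists C, forall k t, Rabs t <= rad -> Rabs (x t - u k t) <= q ^ k * C).
  { intros rad. destruct (B rad) as [C HC]. exists C. intros k t Ht.
    apply (is_lim_seq_le (fun m => Rabs (u (m + k)%nat t - u k t)) (fun _ => q ^ k * C)
             (Finite (Rabs (x t - u k t))) (Finite (q ^ k * C))).
    - intros m; apply HC, Ht.
    - apply (is_lim_seq_abs (fun m => u (m + k)%nat t - u k t) (Finite (x t - u k t))).
      apply is_lim_seq_minus'; [|apply is_lim_seq_const].
      apply (is_lim_seq_incr_n (fun m => u m t) k), Lx.
    - apply is_lim_seq_const. }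
  assert (xc : forall t, continuous x t).
  { intros t. apply continuous_eps. intros eps. assert (He := cond_pos eps).
    destruct (E (Rabs t + 1)) as [C HC].
    destruct (geom_small q C (eps / 3) Hq ltac:(lra)) as [k Hk].
    destruct (continuous_eps_inv (u k) t (uc k t) (mkposreal (eps / 3) ltac:(lra))) as [e Hce].
    simpl in Hce. assert (Hm : 0 < Rmin e 1) by (apply Rmin_pos; [apply cond_pos|lra]).
    exists (mkposreal _ Hm). simpl. intros y Hy.
    assert (Hy1 := Rlt_le_trans _ _ _ Hy (Rmin_l _ _)).
    assert (Hy2 := Rlt_le_trans _ _ _ Hy (Rmin_r _ _)).
    assert (Hyt : Rabs y <= Rabs t + 1).
    { replace y with (t + (y - t)) by ring. eapply Rle_trans; [apply Rabs_triang|lra]. }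
    assert (A1 := HC k y Hyt). assert (A2 := HC k t ltac:(lra)). assert (A3 := Hce y Hy1).
    rewrite (Rabs_minus_sym (x t)) in A2.
    replace (x y - x t) with ((x y - u k y) + ((u k y - u k t) + (u k t - x t))) by ring.
    eapply Rle_lt_trans; [apply Rabs_triang|].
    eapply Rle_lt_trans; [apply Rplus_le_compat_l, Rabs_triang|]. lra. }
  exists x. split; [exact xc|]. intros t.
  destruct (E (Rabs t)) as [C HC].
  (* Both [x] and [T x] are within [q^k C] of the iterate [u (S k)]; letting [k] grow forces
     [x t = T x t]. *)
  assert (Z : forall k, Rabs (x t - T x t) <= q ^ k * (2 * C)).
  { intros k. assert (A1 := HC (S k) t (Rle_refl _)).
    assert (A2 := Tq (Rabs t) (q ^ k * C) (u k) x (uc k) xc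
      ltac:(intros z Hz; rewrite Rabs_minus_sym; apply HC, Hz) t (Rle_refl _)).
    change (T (u k)) with (u (S k)) in A2. simpl pow in A1.
    assert (A3 : q * (q ^ k * C) <= q ^ k * C).
    { rewrite <- (Rmult_1_l (q ^ k * C)) at 2. apply Rmult_le_compat_r; [|lra].
      eapply Rle_trans; [apply Rabs_pos|apply (HC k t (Rle_refl _))]. }
    replace (x t - T x t) with ((x t - u (S k) t) + (u (S k) t - T x t)) by ring.
    eapply Rle_trans; [apply Rabs_triang|]. lra. }
  destruct (Req_dec (x t) (T x t)) as [Ht|Ht]; [exact Ht|].
  assert (Hp : 0 < Rabs (x t - T x t)) by (apply Rabs_pos_lt; lra).
  destruct (geom_small q (2 * C) _ Hq Hp) as [k Hk]. specialize (Z k). lra.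
Qed.

Lemma exp_le_compat (x y : R) : x <= y -> exp x <= exp y.
Proof. intros [H|H]; [left; apply exp_increasing, H|right; f_equal; exact H]. Qed.

Lemma continuous_exp_fun (f : R -> R) (t : R) : continuous f t -> continuous (fun s => exp (f s)) t.
Proof. intros H. apply (continuous_comp f exp); [exact H|apply continuous_exp]. Qed.

Lemma continuous_ln_fun (f : R -> R) (t : R) :
  0 < f t -> continuous f t -> continuous (fun s => ln (f s)) t.
Proof.
  intros H0 H. apply (continuous_comp f ln); [exact H|].
  apply continuity_pt_filterlim, derivable_continuous_pt.
  exists (/ f t). apply derivable_pt_lim_ln, H0.
Qed.

Lemma continuous_Rpower_fun (f : R -> R) (d t : R) :
  0 < f t -> continuous f t -> continuous (fun s => Rpower (f s) d) t.
Proof.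
  intros H0 H. apply (continuous_exp_fun (fun s => d * ln (f s))).
  apply (continuous_mult (fun _ => d) (fun s => ln (f s))); [apply continuous_const|].
  apply continuous_ln_fun; assumption.
Qed.

(** * The nested averaging operator and its fixed point *)

Section emden.
Variables (al beta : R) (a b c : R -> R).
Hypothesis Hbeta : 1 <= beta.
Hypothesis Hal : 0 <= al.
Hypotheses (ac : forall t, continuous a t) (bc : forall t, continuous b t)
  (cc : forall t, continuous c t).
Hypotheses (apos : forall t, 0 < a t) (bpos : forall t, 0 < b t) (cpos : forall t, 0 < c t).

Definition inner_average (u : R -> R) : R -> R :=
  average (beta - 1) (fun t => a t * Rpower (u t) (- al)).

(** The two averages are the two integrations of [(rho phi^2 v')' = gamma rho phi U^(gamma-1)] with
    the powers of [s] divided out. In the application [al = 1 - gamma], [a = rho phi],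
    [b = 1/(rho phi^2)] and [c = (2/beta^2) phi]. *)
Definition emden_op (u : R -> R) (t : R) : R :=
  c t * average beta (fun s => b s * inner_average u s) t.

Let Hb0 : 0 <= beta := Rle_trans _ _ _ Rle_0_1 Hbeta.
Let Hb1 : 0 <= beta - 1 := proj1 (Rminus_le_0 1 beta) Hbeta.

Lemma continuous_source (u : R -> R) : (forall t, continuous u t) -> (forall t, 0 < u t) ->
  forall t, continuous (fun t => a t * Rpower (u t) (- al)) t.
Proof.
  intros uc up t. apply (continuous_mult a (fun t => Rpower (u t) (- al))); [apply ac|].
  apply continuous_Rpower_fun; [apply up|apply uc].
Qed.

Lemma inner_average_pos (u : R -> R) : (forall t, continuous u t) -> (forall t, 0 < u t) ->
  forall t, 0 < inner_average u t.
Proof.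
  intros uc up t. unfold inner_average. apply average_pos; [exact Hb1|apply continuous_source; assumption|].
  intros s; apply Rmult_lt_0_compat; [apply apos|apply exp_pos].
Qed.

Lemma continuous_inner_average (u : R -> R) : (forall t, continuous u t) -> (forall t, 0 < u t) ->
  forall t, continuous (inner_average u) t.
Proof.
  intros uc up t. unfold inner_average. apply continuous_average; [exact Hb1|apply continuous_source; assumption].
Qed.

Lemma continuous_outer (u : R -> R) : (forall t, continuous u t) -> (forall t, 0 < u t) ->
  forall t, continuous (fun s => b s * inner_average u s) t.
Proof.
  intros uc up t. apply (continuous_mult b (inner_average u)); [apply bc|].
  apply continuous_inner_average; assumption.
Qed.

Lemma outer_pos (u : R -> R) : (forall t, continuous u t) -> (forall t, 0 < u t) ->
  forall t, 0 < b t * inner_average u t.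
Proof.
  intros uc up t. apply Rmult_lt_0_compat; [apply bpos|apply inner_average_pos; assumption].
Qed.

Lemma emden_op_pos (u : R -> R) : (forall t, continuous u t) -> (forall t, 0 < u t) ->
  forall t, 0 < emden_op u t.
Proof.
  intros uc up t. unfold emden_op. apply Rmult_lt_0_compat; [apply cpos|].
  apply average_pos; [exact Hb0|apply continuous_outer; assumption|apply outer_pos; assumption].
Qed.

Lemma continuous_emden_op (u : R -> R) : (forall t, continuous u t) -> (forall t, 0 < u t) ->
  forall t, continuous (emden_op u) t.
Proof.
  intros uc up t.
  apply (continuous_mult c (average beta (fun s => b s * inner_average u s))); [apply cc|].
  apply continuous_average; [exact Hb0|apply continuous_outer; assumption].
Qed.

(** Both averages are point evaluations at 0. Applied to a fixed point, this determines [u 0], hence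
    the slope at the free boundary. *)
Lemma emden_op_0 (u : R -> R) : emden_op u 0 = c 0 * b 0 * a 0 * Rpower (u 0) (- al).
Proof.
  unfold emden_op, inner_average. rewrite average_0, average_0. ring.
Qed.

Lemma Rmax_abs_bound (t rad s : R) : Rabs t <= rad -> 0 <= s <= Rmax 0 t -> Rabs s <= rad.
Proof.
  intros Ht Hs. assert (Rmax 0 t <= Rabs t) by (apply Rmax_lub; [apply Rabs_pos|apply Rle_abs]).
  rewrite Rabs_pos_eq; lra.
Qed.

(** Order reversal and homogeneity of degree [-al] combined: [e^y <= e^d e^x] gives
    [(e^x)^(-al) <= e^(al d) (e^y)^(-al)], and the positive averages preserve this. It is a
    one-sided Lipschitz bound in logarithmic variables. *)
Lemma emden_op_exp_le (x y : R -> R) (rad d : R) :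
  (forall t, continuous x t) -> (forall t, continuous y t) ->
  (forall t, Rabs t <= rad -> y t <= x t + d) ->
  forall t, Rabs t <= rad ->
    emden_op (fun s => exp (x s)) t <= exp (al * d) * emden_op (fun s => exp (y s)) t.
Proof.
  intros xc yc H.
  assert (xc' : forall t, continuous (fun s => exp (x s)) t) by (intros; apply continuous_exp_fun, xc).
  assert (yc' : forall t, continuous (fun s => exp (y s)) t) by (intros; apply continuous_exp_fun, yc).
  assert (Hx := fun t => exp_pos (x t)). assert (Hy := fun t => exp_pos (y t)).
  assert (I : forall t, Rabs t <= rad ->
    inner_average (fun s => exp (x s)) t <= exp (al * d) * inner_average (fun s => exp (y s)) t).
  { intros t Ht. unfold inner_average.
    rewrite <- average_scal by (exact Hb1 || apply continuous_source; assumption).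
    apply average_le; [exact Hb1|apply continuous_source; assumption| |].
    - intros s. apply (continuous_mult (fun _ => exp (al * d))); [apply continuous_const|].
      apply (continuous_source (fun s => exp (y s))); assumption.
    - intros s Hs. assert (H' := H s (Rmax_abs_bound t rad s Ht Hs)).
      unfold Rpower. rewrite !ln_exp.
      replace (exp (al * d) * (a s * exp (- al * y s))) with (a s * exp (al * d - al * y s))
        by (unfold Rminus; rewrite exp_plus, Ropp_mult_distr_l; ring).
      apply Rmult_le_compat_l; [apply Rlt_le, apos|].
      apply exp_le_compat. nra. }
  intros t Ht. unfold emden_op.
  rewrite (Rmult_comm (c t)), (Rmult_comm (c t)), <- Rmult_assoc.
  apply Rmult_le_compat_r; [apply Rlt_le, cpos|].
  rewrite <- average_scal by (exact Hb0 || apply (continuous_outer (fun s => exp (y s))); assumption).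
  apply average_le; [exact Hb0|apply (continuous_outer (fun s => exp (x s))); assumption| |].
  - intros s. apply (continuous_mult (fun _ => exp (al * d))); [apply continuous_const|].
    apply (continuous_outer (fun s => exp (y s))); assumption.
  - intros s Hs. replace (exp (al * d) * (b s * inner_average (fun s => exp (y s)) s))
      with (b s * (exp (al * d) * inner_average (fun s => exp (y s)) s)) by ring.
    apply Rmult_le_compat_l; [apply Rlt_le, bpos|].
    apply I, (Rmax_abs_bound t); assumption.
Qed.

Lemma emden_fixed_point : al < 1 \/ (al = 1 /\ beta = 1) ->
  exists u, (forall t, continuous u t) /\ (forall t, 0 < u t) /\ (forall t, u t = emden_op u t).
Proof.
  intros [H|[H1 H2]].
  (* In the variable [x = ln u] the preceding bound, used in both directions, says that [T] is an
     [al]-contraction. *)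
  - set (T := fun x t => ln (emden_op (fun s => exp (x s)) t)).
    assert (Ec : forall x : R -> R, (forall t, continuous x t) ->
      forall t, continuous (fun s => exp (x s)) t) by (intros; apply continuous_exp_fun; auto).
    assert (Ep : forall (x : R -> R) t, 0 < exp (x t)) by (intros; apply exp_pos).
    assert (D : forall rad d x y, (forall t, continuous x t) -> (forall t, continuous y t) ->
      (forall t, Rabs t <= rad -> Rabs (x t - y t) <= d) ->
      forall t, Rabs t <= rad -> T x t - T y t <= al * d).
    { intros rad d x y xc yc Hd t Ht.
      assert (K := emden_op_exp_le x y rad d xc yc
        ltac:(intros s Hs; specialize (Hd s Hs); apply Rabs_le_between in Hd; lra) t Ht).
      apply ln_le in K; [|apply emden_op_pos; auto].
      rewrite ln_mult, ln_exp in K; [|apply exp_pos|apply emden_op_pos; auto].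
      unfold T; lra. }
    destruct (banach_locally_uniform T al) as [x [xc Hx]].
    + lra.
    + intros x xc t. apply continuous_ln_fun; [apply emden_op_pos; auto|].
      apply continuous_emden_op; auto.
    + intros rad d x y xc yc Hd t Ht. apply Rabs_le_between. split.
      * assert (K := D rad d y x yc xc
          ltac:(intros s Hs; rewrite Rabs_minus_sym; apply Hd, Hs) t Ht). lra.
      * apply (D rad d x y xc yc Hd t Ht).
    + exists (fun t => exp (x t)). split; [auto|split; [auto|]].
      intros t. rewrite Hx at 1. unfold T. apply exp_ln, emden_op_pos; auto.
  - (* Here the inner average only sees [u 0], so one application of the operator suffices. *)
    set (w := sqrt (c 0 * b 0 * a 0)).
    assert (Hp : 0 < c 0 * b 0 * a 0)
      by (apply Rmult_lt_0_compat; [apply Rmult_lt_0_compat|]; auto).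
    assert (Hw : 0 < w) by (apply sqrt_lt_R0, Hp).
    assert (wc : forall t, continuous (fun _ : R => w) t) by (intros; apply continuous_const).
    assert (L : forall u v, u 0 = v 0 -> forall t, emden_op u t = emden_op v t).
    { intros u v E t. unfold emden_op. f_equal. unfold average at 1 2. apply RInt_ext.
      intros y _. f_equal. unfold inner_average.
      rewrite !average_d0 by lra. rewrite E. reflexivity. }
    exists (emden_op (fun _ => w)). split; [apply continuous_emden_op; auto|].
    split; [apply emden_op_pos; auto|].
    (* The choice [w^2 = c 0 b 0 a 0] makes the operator applied to the constant [w] take the value
       [w] at 0, so applying the operator again changes nothing. *)
    apply L. rewrite emden_op_0, H1, Rpower_Ropp, Rpower_1 by exact Hw.
    rewrite <- (sqrt_sqrt (c 0 * b 0 * a 0)) by lra. fold w. field. lra.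
Qed.
End emden.

(** * The solution *)

Lemma is_derive_shift (f : R -> R) (a r l : R) :
  is_derive f (r - a) l -> is_derive (fun t => f (t - a)) r l.
Proof.
  intros H. eapply is_derive_eq.
  - apply (is_derive_comp f (fun t => t - a) r l 1); [exact H|]. auto_derive; [exact I|ring].
  - unfold scal; simpl; unfold mult; simpl; ring.
Qed.

Lemma is_derive_mult_R (f g : R -> R) (r f1 g1 : R) : is_derive f r f1 -> is_derive g r g1 ->
  is_derive (fun t => f t * g t) r (f1 * g r + f r * g1).
Proof.
  intros Hf Hg. apply (is_derive_mult f g r); [exact Hf|exact Hg|intros; apply Rmult_comm].
Qed.

Definition weight (n : nat) (r : R) : R := Rpower r (INR n - 1) * exp (r * r / 4).

Lemma weight_pos (n : nat) (r : R) : 0 < weight n r.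
Proof. apply Rmult_lt_0_compat; apply exp_pos. Qed.

Lemma is_derive_weight (n : nat) (r : R) : 0 < r ->
  is_derive (weight n) r (((INR n - 1) / r + r / 2) * weight n r).
Proof.
  intros Hr. eapply is_derive_eq.
  - apply is_derive_mult_R; [apply is_derive_Rpower, Hr|].
    instantiate (1 := r / 2 * exp (r * r / 4)). auto_derive; [exact I|]. unfold Rdiv; ring_simplify; field.
  - unfold weight. replace (INR n - 1 - 1) with ((INR n - 1) + - (1)) by ring.
    rewrite Rpower_plus, Rpower_Ropp, Rpower_1 by exact Hr. field. lra.
Qed.

Lemma continuous_Rmax_0 (s : R) : continuous (fun s => Rmax 0 s) s.
Proof.
  apply (continuous_ext (fun s => (s + Rabs s) / 2)).
  - intros t. change ((t + Rabs t) / 2 = Rmax 0 t). unfold Rmax. destruct (Rle_dec 0 t) as [H|H];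
      [rewrite Rabs_pos_eq by lra|rewrite Rabs_left by lra]; field.
  - apply (continuous_mult (fun s => s + Rabs s) (fun _ => / 2)); [|apply continuous_const].
    apply (continuous_plus (fun s => s) Rabs); [apply continuous_id|apply continuous_Rabs].
Qed.

Lemma solution_exists (n : nat) (gamma Rr : R) :
  (1 <= n)%nat -> 0 <= gamma <= 1 -> 0 < Rr ->
  let beta := 2 / (2 - gamma) in
  exists U U1 : R -> R,
    (forall r, continuous U r) /\ U Rr = 0 /\
    (forall r, Rr < r -> 0 < U r) /\
    (forall r, Rr < r -> is_derive U r (U1 r)) /\
    (forall r, Rr < r -> is_derive U1 r
       (gamma * Rpower (U r) (gamma - 1) + beta / 2 * U r - ((INR n - 1) / r + r / 2) * U1 r)) /\
    filterlim (fun r => Rpower (U r) (1 / beta) / (r - Rr))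
      (at_right Rr) (locally (sqrt 2 / beta)).
Proof.
  intros Hn Hg HR beta.
  (* From here on only this relation is kept. It says [beta (gamma - 1) = beta - 2], which balances
     the powers of [s] in the equation. *)
  assert (Hbd : beta * (2 - gamma) = 2) by (unfold beta; field; lra).
  clearbody beta. assert (Hb1 : 1 <= beta) by nra.
  destruct (homogeneous_solution n beta Hn ltac:(lra)) as [phi [phi1 [Hphi [Dphi Dphi1]]]].
  set (rho := weight n).
  assert (Hrho : forall r, 0 < rho r) by (intros; apply weight_pos).
  (* The map [s -> R + s], frozen at [R] for [s < 0]: the coefficients become positive continuous
     functions on the whole line, as the fixed point result demands. *)
  set (cl := fun s => Rr + Rmax 0 s).
  assert (Hcl : forall s, 0 < cl s) by (intros s; unfold cl; assert (K := Rmax_l 0 s); lra).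
  assert (Hcl' : forall r, Rr < r -> cl (r - Rr) = r).
  { intros r Hr. unfold cl. rewrite Rmax_right; lra. }
  assert (clc : forall s, continuous cl s).
  { intros s. apply (continuous_plus (fun _ => Rr) (fun s => Rmax 0 s));
      [apply continuous_const|apply continuous_Rmax_0]. }
  assert (phic : forall s, continuous (fun s => phi (cl s)) s).
  { intros s. apply (continuous_comp cl phi); [apply clc|eapply is_derive_continuous, Dphi]. }
  assert (rhoc : forall s, continuous (fun s => rho (cl s)) s).
  { intros s. apply (continuous_comp cl rho); [apply clc|].
    eapply is_derive_continuous, is_derive_weight, Hcl. }
  set (a := fun s => rho (cl s) * phi (cl s)).
  set (b := fun s => / (rho (cl s) * phi (cl s) * phi (cl s))).
  set (c := fun s => 2 / (beta * beta) * phi (cl s)).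
  assert (ac : forall s, continuous a s)
    by (intros s; apply (continuous_mult (fun s => rho (cl s)) (fun s => phi (cl s))); auto).
  assert (ap : forall s, 0 < a s) by (intros; apply Rmult_lt_0_compat; auto).
  assert (bc : forall s, continuous b s).
  { intros s. apply continuous_Rinv_comp; [|apply Rgt_not_eq, Rmult_lt_0_compat; [apply ap|auto]].
    apply (continuous_mult a (fun s => phi (cl s))); auto. }
  assert (bp : forall s, 0 < b s)
    by (intros; apply Rinv_0_lt_compat, Rmult_lt_0_compat; [apply ap|auto]).
  assert (cc : forall s, continuous c s).
  { intros s. apply (continuous_mult (fun _ => 2 / (beta * beta)) (fun s => phi (cl s)));
      [apply continuous_const|auto]. }
  assert (cp : forall s, 0 < c s).
  { intros; apply Rmult_lt_0_compat; [|auto]. apply Rdiv_lt_0_compat; nra. }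
  destruct (emden_fixed_point (1 - gamma) beta a b c Hb1 ltac:(lra) ac bc cc ap bp cp)
    as [u [uc [up Hu]]].
  { destruct (Req_dec gamma 0) as [E|E]; [right|left; lra].
    split; [lra|]. rewrite E in Hbd; lra. }
  set (I := inner_average (1 - gamma) beta a u).
  assert (Ic := continuous_outer (1 - gamma) beta a b Hb1 ac bc u uc up).
  fold I in Ic.
  (* [v] is [U / phi] and [F] is the flux [rho phi^2 v']; [Dv] and [DF] below differentiate the two
     averages and recover the divergence form of the equation. *)
  set (v := fun r => 2 / (beta * beta) *
     (Rpower (r - Rr) beta * average beta (fun s => b s * I s) (r - Rr))).
  set (F := fun r => 2 / beta * (Rpower (r - Rr) (beta - 1) * I (r - Rr))).
  (* Using [pos_power] makes [U] vanish for [r <= R], so it is continuous on the whole line. *)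
  set (U := fun r => pos_power beta (r - Rr) * u (r - Rr)).
  set (U1 := fun r => phi1 r * v r + F r * / (rho r * phi r)).
  assert (EU : forall r, Rr < r -> U r = phi r * v r).
  { intros r Hr. unfold U. rewrite pos_power_pos by lra. rewrite Hu. unfold emden_op, v, c.
    fold I. rewrite Hcl' by exact Hr. ring. }
  assert (Up : forall r, Rr < r -> 0 < U r).
  { intros r Hr. unfold U. rewrite pos_power_pos by lra.
    apply Rmult_lt_0_compat; [apply exp_pos|apply up]. }
  assert (Dv : forall r, Rr < r -> is_derive v r (F r * / (rho r * phi r * phi r))).
  { intros r Hr. unfold v. eapply is_derive_eq.
    - apply is_derive_scal.
      apply (is_derive_shift (fun s => Rpower s beta * average beta (fun s => b s * I s) s)).
      apply is_derive_average; [lra|exact Ic|lra].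
    - unfold F, b. rewrite Hcl' by exact Hr. field.
      repeat split; try (apply Rgt_not_eq; apply Hphi || apply Hrho); lra. }
  assert (DF : forall r, Rr < r -> is_derive F r (gamma * (rho r * phi r) * Rpower (U r) (gamma - 1))).
  { intros r Hr. unfold F. eapply is_derive_eq.
    - apply is_derive_scal.
      apply (is_derive_shift (fun s => Rpower s (beta - 1) * I s)).
      unfold I, inner_average.
      apply is_derive_average; [lra|apply continuous_source; assumption|lra].
    - unfold a, U. rewrite pos_power_pos, Hcl' by lra.
      rewrite <- Rpower_mult_distr by (apply exp_pos || apply up).
      rewrite Rpower_mult.
      replace (beta * (gamma - 1)) with (beta - 1 - 1) by lra.
      replace (- (1 - gamma)) with (gamma - 1) by ring.
      transitivity (2 / beta * (beta - 1) * (rho r * phi r) *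
         (Rpower (r - Rr) (beta - 1 - 1) * Rpower (u (r - Rr)) (gamma - 1))); [ring|].
      (* This is where the prefactor [2 / beta^2] of the operator pays off: it produces exactly the
         coefficient [gamma] of the source. *)
      replace (2 / beta * (beta - 1)) with gamma; [ring|].
      apply (Rmult_eq_reg_l beta); [|lra]. field_simplify; lra. }
  assert (DU : forall r, Rr < r -> is_derive U r (U1 r)).
  { intros r Hr. apply is_derive_ext_loc with (fun r => phi r * v r).
    { generalize (open_gt Rr r Hr). apply filter_imp. intros t Ht. symmetry; apply EU, Ht. }
    eapply is_derive_eq; [apply is_derive_mult_R; [apply Dphi|apply Dv, Hr]|].
    unfold U1. field. split; apply Rgt_not_eq; apply Hphi || apply Hrho. }
  exists U, U1. split; [|split; [|split; [exact Up|split; [exact DU|split]]]].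
  - intros r. apply (continuous_comp (fun r => r - Rr) (fun s => pos_power beta s * u s)).
    + eapply is_derive_continuous. auto_derive; [exact Logic.I|reflexivity].
    + apply (continuous_mult (pos_power beta) u); [apply continuous_pos_power; lra|apply uc].
  - unfold U. rewrite pos_power_nonpos by lra. ring.
  - intros r Hr. assert (H0 : 0 < r) by lra. eapply is_derive_eq.
    + apply (is_derive_plus (fun r => phi1 r * v r) (fun r => F r * / (rho r * phi r))).
      * apply is_derive_mult_R; [apply Dphi1, H0|apply Dv, Hr].
      * apply is_derive_mult_R; [apply DF, Hr|].
        apply (is_derive_inv (fun r => rho r * phi r)).
        -- apply is_derive_mult_R; [apply is_derive_weight, H0|apply Dphi].
        -- apply Rgt_not_eq, Rmult_lt_0_compat; auto.
    (* The terms [phi1 F / (rho phi^2)] from the two products cancel, and [rho' = A rho] collects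
       the rest into [-A U1]. *)
    + fold rho. unfold plus; simpl. set (P := Rpower (U r) (gamma - 1)).
      rewrite (EU r Hr). unfold U1. field.
      repeat split; try (apply Rgt_not_eq; apply Hphi || apply Hrho); lra.
  (* Since [-(1 - gamma) = 1 - 2/beta], the fixed point equation at 0 reads
     [u(0) = (2/beta^2) u(0)^(1 - 2/beta)]; thus [x = u(0)^(1/beta)] satisfies [x^2 = 2/beta^2]. *)
  - assert (E0 : Rpower (u 0) (1 / beta) = sqrt 2 / beta).
    { assert (K := Hu 0). rewrite emden_op_0 in K. unfold a, b, c in K.
      replace (- (1 - gamma)) with (1 + - (2 / beta)) in K 
        by (rewrite <- Hbd; field; lra).
      rewrite Rpower_plus, Rpower_1, Rpower_Ropp in K by apply up.
      replace (2 / beta) with (1 / beta + 1 / beta) in K by (field; lra).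
      rewrite Rpower_plus in K.
      assert (Hx : 0 < Rpower (u 0) (1 / beta)) by apply exp_pos.
      set (x := Rpower (u 0) (1 / beta)) in *.
      assert (Kx : x * x = 2 / (beta * beta)).
      { apply (Rmult_eq_reg_l (u 0)); [|apply Rgt_not_eq, up].
        rewrite K at 1. field.
        repeat split; try (apply Rgt_not_eq; apply Hphi || apply Hrho); lra. }
      apply Rsqr_inj; [lra| |].
      - apply Rlt_le, Rdiv_lt_0_compat; [apply sqrt_lt_R0; lra|lra].
      - rewrite Rsqr_div', Rsqr_sqrt by lra. unfold Rsqr. exact Kx. }
    (* For [r > R] the difference quotient is exactly [u(r - R)^(1/beta)], which is continuous at
       [R]. *)
    apply (filterlim_ext_loc (fun r => Rpower (u (r - Rr)) (1 / beta))).
    + exists (mkposreal 1 Rlt_0_1). intros r _ Hr.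
      unfold U. rewrite pos_power_pos by lra.
      rewrite <- Rpower_mult_distr by (apply exp_pos || apply up).
      rewrite Rpower_mult. replace (beta * (1 / beta)) with 1 by (field; lra).
      rewrite Rpower_1 by lra. field. lra.
    + eapply filterlim_filter_le_1; [apply filter_le_within|].
      rewrite <- E0. replace (u 0) with (u (Rr - Rr)) by (f_equal; ring).
      apply (continuous_Rpower_fun (fun r => u (r - Rr))); [apply up|].
      apply (continuous_comp (fun r => r - Rr) u); [|apply uc].
      eapply is_derive_continuous. auto_derive; [exact Logic.I|reflexivity].
Qed.

(** * Monotonicity and growth *)

(** Differentiability is asked only inside the interval, so that [R] itself, where [U] is merely
    continuous, may serve as an endpoint. *)
Lemma le_of_derive_nonneg (f f1 : R -> R) (a b : R) : a <= b ->
  (forall x, a < x < b -> is_derive f x (f1 x) /\ 0 <= f1 x) ->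
  (forall x, a <= x <= b -> continuous f x) -> f a <= f b.
Proof.
  intros Hab Hd Hc.
  (* The mean value point may be an endpoint, where the sign of [f1] is unknown; [Rmax 0] makes the
     value nonnegative there as well. *)
  destruct (MVT_gen f a b (fun x => Rmax 0 (f1 x))) as [c [_ E]].
  - rewrite Rmin_left, Rmax_right by exact Hab. intros x Hx.
    destruct (Hd x Hx) as [D P]. rewrite Rmax_right by exact P. exact D.
  - rewrite Rmin_left, Rmax_right by exact Hab. intros x Hx.
    apply continuity_pt_filterlim, Hc, Hx.
  - assert (P := Rmax_l 0 (f1 c)). nra.
Qed.

(* If the Wronskian against a positive supersolution [psi] were nonpositive at [r], it would be so
   on [(Rr, r)], hence [U / psi] could not grow from its value [0] at [Rr]. *)
Lemma wronskian_pos (n : nat) (Rr k : R) (U U1 f psi psi1 psi2 : R -> R) :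
  0 < Rr -> (forall r, continuous U r) -> U Rr = 0 ->
  (forall r, Rr < r -> 0 < U r) -> (forall r, Rr < r -> is_derive U r (U1 r)) ->
  (forall r, Rr < r -> is_derive U1 r (f r + k * U r - ((INR n - 1) / r + r / 2) * U1 r)) ->
  (forall r, Rr < r -> 0 <= f r) ->
  (forall r, 0 < psi r) -> (forall r, is_derive psi r (psi1 r)) ->
  (forall r, is_derive psi1 r (psi2 r)) ->
  (forall r, Rr < r -> psi2 r + ((INR n - 1) / r + r / 2) * psi1 r <= k * psi r) ->
  forall r, Rr < r -> 0 < psi r * U1 r - psi1 r * U r.
Proof.
  intros HR Uc U0 Up DU DU1 Hf Pp DP DP1 L r Hr.
  (* The weight absorbs the first-order terms, leaving in [W'] only [f >= 0] and the supersolution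
     defect of [psi], both with nonnegative factors. *)
  set (W := fun t => weight n t * (psi t * U1 t - psi1 t * U t)).
  set (W1 := fun t => weight n t *
     (psi t * f t + U t * (k * psi t - (psi2 t + ((INR n - 1) / t + t / 2) * psi1 t)))).
  assert (DW : forall t, Rr < t -> is_derive W t (W1 t)).
  { intros t Ht. eapply is_derive_eq.
    - apply is_derive_mult_R; [apply is_derive_weight; lra|].
      apply (is_derive_minus (fun t => psi t * U1 t) (fun t => psi1 t * U t)).
      + apply is_derive_mult_R; [apply DP|apply DU1, Ht].
      + apply is_derive_mult_R; [apply DP1|apply DU, Ht].
    - unfold W1, minus, plus, opp; simpl. ring. }
  assert (W1p : forall t, Rr < t -> 0 <= W1 t).
  { intros t Ht. apply Rmult_le_pos; [apply Rlt_le, weight_pos|].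
    apply Rplus_le_le_0_compat; apply Rmult_le_pos.
    - apply Rlt_le, Pp.
    - apply Hf, Ht.
    - apply Rlt_le, Up, Ht.
    - specialize (L t Ht). lra. }
  destruct (Rlt_le_dec 0 (psi r * U1 r - psi1 r * U r)) as [H|H]; [exact H|exfalso].
  assert (N : forall t, Rr < t < r -> psi t * U1 t - psi1 t * U t <= 0).
  { intros t Ht.
    assert (M : W t <= W r).
    { apply (le_of_derive_nonneg W W1); [lra| |].
      - intros x Hx. split; [apply DW|apply W1p]; lra.
      - intros x Hx. eapply is_derive_continuous, DW; lra. }
    unfold W in M. assert (P1 := weight_pos n t). assert (P2 := weight_pos n r). nra. }
  assert (C : - (U Rr * / psi Rr) <= - (U r * / psi r)).
  { apply (le_of_derive_nonneg (fun t => - (U t * / psi t))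
      (fun t => (psi1 t * U t - psi t * U1 t) * / (psi t * psi t))); [lra| |].
    - intros t Ht. split.
      + eapply is_derive_eq.
        * apply (is_derive_opp (fun t => U t * / psi t)).
          apply is_derive_mult_R; [apply DU; lra|].
          apply is_derive_inv; [apply DP|apply Rgt_not_eq, Pp].
        * unfold opp; simpl. field. apply Rgt_not_eq, Pp.
      + apply Rmult_le_pos; [specialize (N t Ht); lra|].
        apply Rlt_le, Rinv_0_lt_compat, Rmult_lt_0_compat; apply Pp.
    - intros t Ht. apply (continuous_opp (fun t => U t * / psi t)).
      apply (continuous_mult U (fun t => / psi t)); [apply Uc|].
      apply continuous_Rinv_comp; [eapply is_derive_continuous, DP|apply Rgt_not_eq, Pp]. }
  rewrite U0, Rmult_0_l, Ropp_0 in C.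
  assert (0 < U r * / psi r) by (apply Rmult_lt_0_compat; [apply Up, Hr|apply Rinv_0_lt_compat, Pp]).
  lra.
Qed.

Lemma decreasing_bounded_below_cvg (K : R -> R) (r1 m : R) :
  (forall r s, r1 <= r -> r <= s -> K s <= K r) -> (forall r, r1 <= r -> m <= K r) ->
  exists l, filterlim K (Rbar_locally p_infty) (locally l).
Proof.
  intros Hd Hm.
  destruct (completeness (fun y => exists r, r1 <= r /\ y = - K r)) as [l [Hub Hlub]].
  - exists (- m). intros y [r [Hr ->]]. specialize (Hm r Hr). lra.
  - exists (- K r1), r1. split; [apply Rle_refl|reflexivity].
  - exists (- l). apply filterlim_locally. intros eps.
    assert (He := cond_pos eps).
    assert (E : exists r, r1 <= r /\ l - eps < - K r).
    { destruct (classic (exists r, r1 <= r /\ l - eps < - K r)) as [H|H]; [exact H|].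
      exfalso. assert (l <= l - eps); [|lra].
      apply Hlub. intros y [r [Hr ->]].
      destruct (Rle_lt_dec (- K r) (l - eps)) as [G|G]; [exact G|].
      exfalso; apply H; exists r; split; assumption. }
    destruct E as [r [Hr Hl]]. exists r. intros x Hx.
    assert (H1 := Hd r x Hr ltac:(lra)).
    assert (H2 : - K x <= l) by (apply Hub; exists x; split; [lra|reflexivity]).
    apply Rabs_def1; unfold minus, plus, opp; simpl; lra.
Qed.

Lemma Rpower_neg_lim (beta : R) : 1 <= beta ->
  filterlim (fun r => Rpower r (- beta)) (Rbar_locally p_infty) (locally 0).
Proof.
  intros Hb. apply filterlim_locally. intros eps. assert (He := cond_pos eps).
  exists (Rmax 1 (/ eps)). intros r Hr.
  assert (H1 := Rle_lt_trans _ _ _ (Rmax_l _ _) Hr).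
  assert (H2 := Rle_lt_trans _ _ _ (Rmax_r _ _) Hr).
  change (Rabs (Rpower r (- beta) - 0) < eps).
  rewrite Rminus_0_r, Rabs_pos_eq by (apply Rlt_le, exp_pos).
  apply Rle_lt_trans with (/ r).
  - replace (/ r) with (Rpower r (- (1))) by (rewrite Rpower_Ropp, Rpower_1; lra).
    apply Rle_Rpower; lra.
  - rewrite <- (Rinv_inv eps). apply Rinv_lt_contravar; [|exact H2].
    apply Rmult_lt_0_compat; [apply Rinv_0_lt_compat, He|lra].
Qed.

(* [(r^2 + 2 n)^(beta/2)] is a supersolution of the homogeneous equation growing exactly like
   [r^beta]: the choice [2 n] cancels all terms but [beta (beta - 2) r^2 (r^2 + 2 n)^(beta/2 - 2)]. *)
Lemma supersolution (n : nat) (beta : R) : (1 <= n)%nat -> 1 <= beta <= 2 ->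
  exists psi psi1 psi2 : R -> R,
    (forall r, 0 < psi r) /\ (forall r, is_derive psi r (psi1 r)) /\
    (forall r, is_derive psi1 r (psi2 r)) /\
    (forall r, 0 < r -> psi2 r + ((INR n - 1) / r + r / 2) * psi1 r <= beta / 2 * psi r) /\
    (forall r, 0 < r -> Rpower r beta <= psi r).
Proof.
  intros Hn Hb. assert (Hn1 : 1 <= INR n) by (apply (le_INR 1); exact Hn).
  set (y := fun r => r * r + 2 * INR n).
  assert (Hy : forall r, 0 < y r) by (intros r; unfold y; nra).
  assert (D : forall d r, is_derive (fun r => Rpower (y r) d) r (2 * r * (d * Rpower (y r) (d - 1)))).
  { intros d r. apply (is_derive_comp (fun y => Rpower y d) y).
    - apply is_derive_Rpower, Hy.
    - unfold y. auto_derive; [exact I|ring]. }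
  exists (fun r => Rpower (y r) (beta / 2)).
  exists (fun r => beta * r * Rpower (y r) (beta / 2 - 1)).
  exists (fun r => beta * Rpower (y r) (beta / 2 - 1)
     + beta * r * (2 * r * ((beta / 2 - 1) * Rpower (y r) (beta / 2 - 1 - 1)))).
  split; [intros; apply exp_pos|split; [|split; [|split]]].
  - intros r. eapply is_derive_eq; [apply (D (beta / 2) r)|field].
  - intros r. apply (is_derive_mult_R (fun r => beta * r) (fun r => Rpower (y r) (beta / 2 - 1))); [|apply (D (beta / 2 - 1) r)].
    auto_derive; [exact I|ring].
  - intros r Hr.
    assert (HP : 0 < Rpower (y r) (beta / 2 - 1 - 1)) by apply exp_pos.
    (* Writing every power of [y] as a multiple of [P = y^(beta/2 - 2)] reduces the inequality to a
       polynomial identity and the sign of [beta (2 - beta)]. *)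
    replace (Rpower (y r) (beta / 2)) with (Rpower (y r) (beta / 2 - 1 - 1) * (y r * y r)).
    2: { rewrite <- (Rpower_1 (y r)) at 2 3 by apply Hy. rewrite <- !Rpower_plus. f_equal. ring. }
    replace (Rpower (y r) (beta / 2 - 1)) with (Rpower (y r) (beta / 2 - 1 - 1) * y r).
    2: { rewrite <- (Rpower_1 (y r)) at 2 by apply Hy. rewrite <- Rpower_plus. f_equal. ring. }
    set (P := Rpower (y r) (beta / 2 - 1 - 1)) in *.
    apply Rminus_le.
    replace (_ - _) with (- (P * (beta * (2 - beta) * (r * r)))) by (unfold y; field; lra).
    assert (0 <= P * (beta * (2 - beta) * (r * r))); [|lra].
    apply Rmult_le_pos; [lra|]. apply Rmult_le_pos; nra.
  - intros r Hr. replace beta with (beta / 2 + beta / 2) at 1 by field.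
    rewrite Rpower_plus, Rpower_mult_distr by exact Hr.
    apply Rle_Rpower_l; [lra|]. unfold y; nra.
Qed.

Lemma solution_asymptotics (n : nat) (gamma Rr beta : R) (U U1 : R -> R) :
  (1 <= n)%nat -> 0 <= gamma <= 1 -> 0 < Rr -> 1 <= beta <= 2 ->
  (forall r, continuous U r) -> U Rr = 0 ->
  (forall r, Rr < r -> 0 < U r) -> (forall r, Rr < r -> is_derive U r (U1 r)) ->
  (forall r, Rr < r -> is_derive U1 r
     (gamma * Rpower (U r) (gamma - 1) + beta / 2 * U r - ((INR n - 1) / r + r / 2) * U1 r)) ->
  (forall r s, Rr < r -> r < s -> U r < U s) /\
  exists c : R, 0 < c /\
     filterlim (fun r => U r / Rpower r beta) (Rbar_locally p_infty) (locally c).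
Proof.
  intros Hn Hg HR Hb Uc U0 Up DU DU1.
  assert (Hn1 : 1 <= INR n) by (apply (le_INR 1); exact Hn).
  assert (Hf : forall r, Rr < r -> 0 <= gamma * Rpower (U r) (gamma - 1))
    by (intros; apply Rmult_le_pos; [lra|apply Rlt_le, exp_pos]).
  assert (U1p : forall r, Rr < r -> 0 < U1 r).
  { intros r Hr. replace (U1 r) with (1 * U1 r - 0 * U r) by ring.
    apply (wronskian_pos n Rr (beta / 2) U U1 (fun r => gamma * Rpower (U r) (gamma - 1))
             (fun _ => 1) (fun _ => 0) (fun _ => 0)); auto; intros.
    - lra.
    - apply (is_derive_const 1).
    - apply (is_derive_const 0).
    - lra. }
  assert (Uinc : forall r s, Rr < r -> r < s -> U r < U s).
  { intros r s Hr Hs. destruct (MVT_gen U r s U1) as [c [Hc E]].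
    - rewrite Rmin_left by lra. intros x Hx. apply DU; lra.
    - intros x _. apply continuity_pt_filterlim, Uc.
    - rewrite Rmin_left in Hc by lra. assert (P := U1p c ltac:(lra)). nra. }
  split; [exact Uinc|].
  set (r1 := Rr + 1). assert (Hr1 : Rr < r1) by (unfold r1; lra).
  (* The source may blow up at [R]. Beyond [r1] it is at most [C0], because [U] increases and the
     exponent [gamma - 1] is nonpositive. *)
  set (C0 := Rpower (U r1) (gamma - 1)).
  assert (HC0 : 0 < C0) by apply exp_pos.
  assert (FC : forall r, r1 <= r -> gamma * Rpower (U r) (gamma - 1) <= C0).
  { intros r Hr.
    assert (Q : Rpower (U r) (gamma - 1) <= C0).
    { unfold C0. replace (gamma - 1) with (- (1 - gamma)) by ring. rewrite !Rpower_Ropp.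
      apply Rinv_le_contravar; [apply exp_pos|]. apply Rle_Rpower_l; [lra|].
      split; [apply Up, Hr1|]. destruct Hr as [Hr|<-]; [left; apply Uinc; assumption|lra]. }
    assert (0 < Rpower (U r) (gamma - 1)) by apply exp_pos. nra. }
  set (Q := fun r => r * U1 r - beta * U r).
  (* The equation gives [Q' = -(r/2) Q - (n + beta - 2) U' + r gamma U^(gamma-1)]. With integrating
     factor [e^(r^2/4)] and equilibrium [2 C0], the function [G] is nondecreasing, since
     [n + beta >= 2]. *)
  set (G := fun r => - (exp (r * r / 4) * (Q r - 2 * C0))).
  assert (HQ : exists C2, 0 <= C2 /\ forall r, r1 <= r -> Q r <= C2).
  { exists (2 * C0 + Rabs (G r1)). split; [assert (P := Rabs_pos (G r1)); lra|]. intros r Hr.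
    assert (M : G r1 <= G r).
    { apply (le_of_derive_nonneg G (fun r => exp (r * r / 4) *
        ((INR n + beta - 2) * U1 r + r * (C0 - gamma * Rpower (U r) (gamma - 1))))); [exact Hr| |].
      2: { intros x Hx. apply (continuous_opp (fun r => exp (r * r / 4) * (Q r - 2 * C0))).
           apply (continuous_mult (fun r => exp (r * r / 4)) (fun r => Q r - 2 * C0)).
           - eapply is_derive_continuous. auto_derive; [exact I|reflexivity].
           - apply (continuous_minus Q (fun _ => 2 * C0)); [|apply continuous_const].
             apply (continuous_minus (fun r => r * U1 r) (fun r => beta * U r)).
             + apply (continuous_mult (fun r => r) U1); [apply continuous_id|].
               eapply is_derive_continuous, DU1; lra.
             + apply (continuous_mult (fun _ => beta) U); [apply continuous_const|apply Uc]. }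
      intros x Hx. split.
      - eapply is_derive_eq.
        + apply (is_derive_opp (fun r => exp (r * r / 4) * (Q r - 2 * C0))).
          apply is_derive_mult_R.
          * instantiate (1 := x / 2 * exp (x * x / 4)).
            auto_derive; [exact I|]. unfold Rdiv; ring_simplify; field.
          * apply (is_derive_minus Q (fun _ => 2 * C0)); [|apply is_derive_const].
            apply (is_derive_minus (fun r => r * U1 r) (fun r => beta * U r)).
            -- apply (is_derive_mult_R (fun r => r)); [apply (is_derive_id x)|apply DU1; lra].
            -- apply (is_derive_scal U), DU; lra.
        + unfold Q, opp, minus, plus, zero, opp, one; simpl. unfold plus, opp, one; simpl.
          set (P := Rpower (U x) (gamma - 1)). field. lra.
      - apply Rmult_le_pos; [apply Rlt_le, exp_pos|]. apply Rplus_le_le_0_compat.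
        + apply Rmult_le_pos; [lra|]. apply Rlt_le, U1p; lra.
        + apply Rmult_le_pos; [lra|]. assert (K := FC x ltac:(lra)). lra. }
    assert (E : 1 <= exp (r * r / 4)).
    { rewrite <- exp_0. apply exp_le_compat. nra. }
    assert (B := Rle_abs (- G r1)). rewrite Rabs_Ropp in B.
    unfold G at 2 in M.
    (* If [Q r > 2 C0], then [Q r - 2 C0 <= -G r <= -G r1], as the exponential is at least 1. *)
    destruct (Rle_lt_dec (Q r) (2 * C0)) as [S|S]; [assert (P := Rabs_pos (G r1)); lra|].
    nra. }
  destruct HQ as [C2 [HC2 HQ]].
  set (H := fun r => U r * Rpower r (- beta)).
  (* Since [H' = Q r^(-beta-1) <= C2 r^(-beta-1)], the added term compensates the possible growth of
     [H] and makes [K] nonincreasing. *)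
  set (K := fun r => H r + C2 / beta * Rpower r (- beta)).
  assert (Kd : forall r s, r1 <= r -> r <= s -> K s <= K r).
  { intros r s Hr Hs. apply Ropp_le_cancel.
    assert (DK : forall x, r1 <= x -> is_derive (fun r => - K r) x
       ((C2 - Q x) * Rpower x (- beta - 1))).
    { intros x Hx. assert (Hx0 : 0 < x) by lra. eapply is_derive_eq.
      - apply (is_derive_opp K).
        apply (is_derive_plus H (fun r => C2 / beta * Rpower r (- beta))).
        + apply is_derive_mult_R; [apply DU; lra|apply is_derive_Rpower, Hx0].
        + apply (is_derive_scal (fun r => Rpower r (- beta))), is_derive_Rpower, Hx0.
      - unfold Q, opp, plus; simpl. unfold mult; simpl.
        replace (Rpower x (- beta)) with (x * Rpower x (- beta - 1)).
        + field. lra.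
        + rewrite <- (Rpower_1 x) at 1 by exact Hx0. rewrite <- Rpower_plus. f_equal. ring. }
    apply (le_of_derive_nonneg (fun r => - K r) (fun x => (C2 - Q x) * Rpower x (- beta - 1)));
      [exact Hs| |].
    - intros x Hx. split; [apply DK; lra|].
      apply Rmult_le_pos; [specialize (HQ x ltac:(lra)); lra|apply Rlt_le, exp_pos].
    - intros x Hx. eapply is_derive_continuous, DK; lra. }
  destruct (supersolution n beta Hn Hb) as [psi [psi1 [psi2 [Pp [DP [DP1 [L Pge]]]]]]].
  (* [U / psi] is nondecreasing, so [U >= kappa psi >= kappa r^beta] beyond [r1]; this keeps the
     limit away from 0. *)
  set (kappa := U r1 / psi r1).
  assert (Hk : 0 < kappa) by (apply Rdiv_lt_0_compat; [apply Up, Hr1|apply Pp]).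
  assert (Hlow : forall r, r1 <= r -> kappa <= H r).
  { intros r Hr. assert (Hr0 : 0 < r) by lra.
    assert (M : U r1 * / psi r1 <= U r * / psi r).
    { assert (DW : forall x, r1 <= x -> is_derive (fun r => U r * / psi r) x
         ((psi x * U1 x - psi1 x * U x) * / (psi x * psi x))).
      { intros x Hx. eapply is_derive_eq.
        - apply is_derive_mult_R; [apply DU; lra|].
          apply is_derive_inv; [apply DP|apply Rgt_not_eq, Pp].
        - simpl. field. apply Rgt_not_eq, Pp. }
      apply (le_of_derive_nonneg (fun r => U r * / psi r) (fun x =>
         (psi x * U1 x - psi1 x * U x) * / (psi x * psi x))); [exact Hr| |].
      - intros x Hx. split; [apply DW; lra|].
        apply Rmult_le_pos; [|apply Rlt_le, Rinv_0_lt_compat, Rmult_lt_0_compat; apply Pp].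
        apply Rlt_le. apply (wronskian_pos n Rr (beta / 2) U U1
          (fun r => gamma * Rpower (U r) (gamma - 1)) psi psi1 psi2); auto; [|lra].
        intros t Ht; apply L; lra.
      - intros x Hx. eapply is_derive_continuous, DW; lra. }
    eapply Rle_trans; [exact M|]. unfold H. rewrite Rpower_Ropp.
    apply Rmult_le_compat_l; [apply Rlt_le, Up; lra|].
    apply Rinv_le_contravar; [apply exp_pos|apply Pge, Hr0]. }
  assert (Hpos : forall r, 0 <= C2 / beta * Rpower r (- beta)).
  { intros r. apply Rmult_le_pos; [|apply Rlt_le, exp_pos].
    apply Rmult_le_pos; [exact HC2|apply Rlt_le, Rinv_0_lt_compat; lra]. }
  destruct (decreasing_bounded_below_cvg K r1 kappa Kd) as [c Hc].
  { intros r Hr. specialize (Hlow r Hr). specialize (Hpos r). unfold K; lra. }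
  assert (HH : filterlim (fun r => U r / Rpower r beta) (Rbar_locally p_infty) (locally c)).
  { apply (filterlim_ext (fun r => K r - C2 / beta * Rpower r (- beta))).
    - intros r. unfold K, H. rewrite Rpower_Ropp. unfold Rdiv; ring.
    - apply (is_lim_minus' K (fun r => C2 / beta * Rpower r (- beta)) p_infty c 0) in Hc.
      + rewrite Rminus_0_r in Hc. exact Hc.
      + replace (Finite 0) with (Rbar_mult (C2 / beta) 0) by (simpl; f_equal; ring).
        apply (is_lim_scal_l (fun r => Rpower r (- beta)) (C2 / beta) p_infty 0).
        apply Rpower_neg_lim; lra. }
  exists c. split; [|exact HH].
  apply Rlt_le_trans with kappa; [exact Hk|].
  apply (filterlim_le (F := Rbar_locally p_infty) (fun _ => kappa) (fun r => U r / Rpower r beta)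
     (Finite kappa) (Finite c)).
  - exists r1. intros r Hr. unfold Rdiv. rewrite <- Rpower_Ropp. apply Hlow; lra.
  - apply filterlim_const.
  - exact HH.
Qed.

Theorem theorem6p1 (n : nat) (gamma : R) :
  (1 <= n)%nat -> 0 <= gamma <= 1 ->
  let beta := 2 / (2 - gamma) in
  forall Rr : R, 0 < Rr ->
  exists U : R -> R,
    continuous_on_closed_right Rr U /\
    C2_on_open_right Rr U /\
    (forall r, Rr < r -> 0 < U r) /\
    (forall r s, Rr < r -> r < s -> U r < U s) /\
    (forall r, Rr < r ->
       Derive (Derive U) r + ((INR n - 1) / r + r / 2) * Derive U r
         - beta / 2 * U r
       = gamma * Rpower (U r) (gamma - 1)) /\
    U Rr = 0 /\
    filterlim (fun r => Rpower (U r) (1 / beta) / (r - Rr))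
      (at_right Rr) (locally (sqrt 2 / beta)) /\
    (exists c : R, 0 < c /\
       filterlim (fun r => U r / Rpower r beta)
         (Rbar_locally p_infty) (locally c)).
Proof.
  intros Hn Hg beta Rr HR.
  destruct (solution_exists n gamma Rr Hn Hg HR) as [U [U1 [Uc [U0 [Up [DU [DU1 Hlim]]]]]]].
  fold beta in DU1, Hlim.
  assert (Hb : 1 <= beta <= 2).
  { assert (beta * (2 - gamma) = 2) by (unfold beta; field; lra). nra. }
  destruct (solution_asymptotics n gamma Rr beta U U1 Hn Hg HR Hb Uc U0 Up DU DU1) as [Uinc Hc].
  assert (Near : forall r, Rr < r -> locally r (fun t => Rr < t)) by (intros r Hr; apply (open_gt Rr r Hr)).
  (* The second derivative is read off the equation; its continuity follows from that of [U] and
     [U1] and from [U > 0]. *)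
  set (U2 := fun r => gamma * Rpower (U r) (gamma - 1) + beta / 2 * U r
                        - ((INR n - 1) / r + r / 2) * U1 r).
  assert (E1 : forall r, Rr < r -> Derive U r = U1 r) by (intros; apply is_derive_unique; auto).
  assert (D2 : forall r, Rr < r -> is_derive (Derive U) r (U2 r)).
  { intros r Hr. apply is_derive_ext_loc with U1; [|apply DU1, Hr].
    generalize (Near r Hr). apply filter_imp. intros t Ht. symmetry; apply E1, Ht. }
  assert (E2 : forall r, Rr < r -> Derive (Derive U) r = U2 r)
    by (intros; apply is_derive_unique; auto).
  exists U. split; [|split; [|split; [exact Up|split; [exact Uinc|split; [|split; [exact U0|
    split; [exact Hlim|exact Hc]]]]]]].
  - intros r _. eapply filterlim_filter_le_1; [apply filter_le_within|apply Uc].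
  - intros r Hr. split; [exists (U1 r); apply DU, Hr|split; [exists (U2 r); apply D2, Hr|]].
    apply (continuous_ext_loc _ U2).
    { generalize (Near r Hr). apply filter_imp. intros t Ht. symmetry; apply E2, Ht. }
    apply (continuous_minus (fun r => gamma * Rpower (U r) (gamma - 1) + beta / 2 * U r)
             (fun r => ((INR n - 1) / r + r / 2) * U1 r)).
    + apply (continuous_plus (fun r => gamma * Rpower (U r) (gamma - 1)) (fun r => beta / 2 * U r)).
      * apply (continuous_mult (fun _ => gamma) (fun r => Rpower (U r) (gamma - 1)));
          [apply continuous_const|]. apply continuous_Rpower_fun; [apply Up, Hr|apply Uc].
      * apply (continuous_mult (fun _ => beta / 2) U); [apply continuous_const|apply Uc].
    + apply (continuous_mult (fun r => (INR n - 1) / r + r / 2) U1).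
      * eapply is_derive_continuous. auto_derive; [lra|reflexivity].
      * eapply is_derive_continuous, DU1, Hr.
  - intros r Hr. rewrite E2, E1 by exact Hr. unfold U2. ring.
Qed.
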